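(* The expected tree sizes $R_n^{(i)}=\mathbb{E} S_n^{(i)}$ satisfy the following. (1) If $q_n>0$ for all $n\in\mathbb{N}$, then for every $i\in\{0,-1,-2,\ldots\}$, $\lim_{n\to\infty}R_n^{(i)}=\infty$; hence $\mathbb{E} S^{(i)}=\infty$. (2) The sequence $(R_n^{(0)})_{n\ge 0}$ is subadditive, that is, $R_{n+m}^{(0)}\le R_n^{(0)}+R_m^{(0)}$ for all integers $n,m\ge 0$ (where, for this item, one sets $R_0^{(0)}=0$). (3) If $q_n>0$ for all $n\in\mathbb{N}$, then for every $i\le 0$, $$\lim_{n\to\infty}\frac{R_n^{(i)}}{n}=0\quad\text{if and only if}\quad \mathbb{E} Z=\infty.$$ (4) If $\mathbb{E} Z<\infty$, then $$\lim_{n\to\infty}\frac{R_n^{(0)}}{n}=\frac{1}{\mathbb{E} Z}.$$ (5) For all distributions of $Z$, all integers $i\le 0$ and all $n\in\mathbb{N}$, $$R_n^{(i)}\le 1+p_{1-i}\,R_n^{(0)}.$$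
   Context: $\mathbb{N}=\{1,2,\ldots\}$. Let $Z,Z_1,Z_2,\ldots$ be independent, identically distributed random variables taking values in $\mathbb{N}$; write $q_n=\mathbb{P}\{Z=n\}$ and $p_n=\mathbb{P}\{Z\ge n\}$ for $n\in\mathbb{N}$. The coloring $(C_n)_{n\in\mathbb{Z}}$ is defined by $C_i=i$ for all integers $i\le 0$ and $C_n=C_{n-Z_n}$ for $n\in\mathbb{N}$. In the associated forest on $\mathbb{Z}$, each $i\le 0$ is the root of a tree, and each $n\in\mathbb{N}$ is attached to its parent $n-Z_n$. For $i\le 0$ and $n\in\mathbb{N}$, the size (including the root) of the tree rooted at $i$ at time $n$ is $S_n^{(i)}=1+\sum_{t=1}^n\mathbf{1}_{\{C_t=i\}}$, the size of the final tree is $S^{(i)}=1+\sum_{t\in\mathbb{N}}\mathbf{1}_{\{C_t=i\}}$, and $R_n^{(i)}=\mathbb{E} S_n^{(i)}$. *)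

(* Defs.v *)
From HB Require Import structures.
From mathcomp Require Import all_boot all_order all_algebra finmap.
From mathcomp Require Import zify.
From mathcomp Require Import all_classical all_reals all_analysis.

Set Implicit Arguments.
Unset Strict Implicit.
Unset Printing Implicit Defensive.

Import Order.TTheory GRing.Theory Num.Theory.

Local Open Scope classical_set_scope.
Local Open Scope ring_scope.

Section Probability.
Context d (T : measurableType d) (R : realType) (P : probability T R).

Definition mutually_independent (I : choiceType) d' (T' : measurableType d')
    (X : I -> {RV P >-> T'}) : Prop :=
  forall (J : {fset I}) (B : I -> set T'),
    (forall j, measurable (B j)) ->
    P (\bigcap_(j in [set` J]) (X j @^-1` B j)) =
      (\prod_(j <- J) P (X j @^-1` B j))%E.

Definition identically_distributed (I : Type) d' (T' : measurableType d')
    (X : I -> {RV P >-> T'}) : Prop :=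
  forall (i j : I) (A : set T'), measurable A ->
    distribution P (X i) A = distribution P (X j) A.

Definition iid (I : choiceType) d' (T' : measurableType d')
    (X : I -> {RV P >-> T'}) : Prop :=
  mutually_independent X /\ identically_distributed X.

Definition point_prob (X : {RV P >-> nat}) (n : nat) : \bar R :=
  P [set w | X w = n].

Definition tail_prob (X : {RV P >-> nat}) (n : int) : \bar R :=
  P [set w | n <= (X w)%:Z].

End Probability.

Section Coloring.
(* [z t] is the realized value of Z_t, used for t >= 1 only. *)
Variable z : nat -> nat.

(* Roots (integers n <= 0) are made fixed points. *)
Definition parent (n : int) : int :=
  if 0 < n then n - (z `|n|%N)%:Z else n.

(* Since z >= 1 on N, at most n steps lead from n > 0 to a root;
   [color_root] and [color_step] below are the defining equations. *)
Definition color (n : int) : int := iter `|n|%N parent n.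

Lemma parent_root n : n <= 0 -> parent n = n.
Proof. by move=> n0; rewrite /parent ltNge n0. Qed.

Lemma iter_parent_root k n : n <= 0 -> iter k parent n = n.
Proof. by move=> n0; elim: k => //= k ->; exact: parent_root. Qed.

Lemma color_root n : n <= 0 -> color n = n.
Proof. exact: iter_parent_root. Qed.

Hypothesis z_gt0 : forall t, (0 < t)%N -> (0 < z t)%N.

Lemma parent_lt n : 0 < n -> parent n < n.
Proof. by move=> n0; rewrite /parent n0; have := @z_gt0 `|n|%N; lia. Qed.

Lemma iter_parent_le0 k n : n <= k%:Z -> iter k parent n <= 0.
Proof.
elim: k n => [//|k IH] n nk; rewrite iterSr; apply: IH.
have [n0|n0] := leP n 0; first by rewrite parent_root//; lia.
by have := parent_lt n0; lia.
Qed.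

Lemma iter_parent_color k n : n <= k%:Z -> iter k parent n = color n.
Proof.
move=> nk; have [n0|n0] := leP n 0; first by rewrite iter_parent_root ?color_root.
have -> : k = ((k - `|n|) + `|n|)%N by lia.
by rewrite iterD iter_parent_root// iter_parent_le0//; lia.
Qed.

Lemma color_step (n : nat) : (0 < n)%N -> color n%:Z = color (n%:Z - (z n)%:Z).
Proof.
case: n => // n _; have := @z_gt0 n.+1 isT => zn.
rewrite {1}/color absz_nat iterSr {2}/parent /= iter_parent_color//; lia.
Qed.

Definition tree_size (i : int) (n : nat) : nat :=
  (1 + \sum_(1 <= t < n.+1) (color t%:Z == i))%N.

Definition final_tree_size (R : realType) (i : int) : \bar R :=
  (1 + \sum_(1 <= t <oo) (color t%:Z == i)%:R%:E)%E.

End Coloring.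

Section ExpectedSizes.
Context d (T : measurableType d) (R : realType) (P : probability T R).
Variable Z : nat -> {RV P >-> nat}.

Definition expected_tree_size (i : int) (n : nat) : \bar R :=
  'E_P[fun w => (tree_size (fun t => Z t w) i n)%:R].

(* The final size may be infinite, hence the integral of an extended-real
   function instead of ['E_P]. *)
Definition expected_final_tree_size (i : int) : \bar R :=
  (\int[P]_w final_tree_size (fun t => Z t w) R i)%E.

End ExpectedSizes.

(* Main.v *)
Require Import Defs.
From HB Require Import structures.
From mathcomp Require Import all_boot all_order all_algebra finmap.
From mathcomp Require Import zify lra.
From mathcomp Require Import all_classical all_reals all_analysis.
From mathcomp Require Import measurable_realfun.

(** For the root 0, the probabilities [u n] that vertex [n] lies in its tree
form a renewal sequence: conditioning on the jump [Z n], which is independent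
of the colors of the earlier vertices, gives
[u n.+1 = \sum_(k < n.+1) f k * u (n - k)] with [f k] the probability that
[Z = k.+1].  Hence the partial sums [U] of [u], which are the expected tree
sizes, solve the renewal equation [U = 1 + f * U] (convolution).  For another
root [i] the tree is empty until some vertex jumps onto [i], and the
expected number of non-root vertices solves the same equation, but with
forcing term [\sum_(k <= n) f (k + |i|)].  This term lies between
[f |i|] and [r |i|], where [r k] is the probability that [Z > k], so
comparison of solutions sandwiches the expected size between [f |i| * U]
and [r |i| * U], up to the root itself and a shift of one step
([mean_size_succ_bounds]).  All items are thereby reduced to the single
sequence [U].

Subadditivity of [U] is an induction on the renewal equation
([renewal_function_subadd]).  The growth of [U] comes from one identity,
[\sum_(k <= n) r k * U (n - k) = n + 1] ([sum_tail_renewal]): summed over the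
times up to [n], it says that at each time exactly one last renewal has
occurred.  As [U] is nondecreasing, the identity gives
[n + 1 <= U n * M n] and [U n * M m <= n + m + 1], where [M] denotes the
partial sums of [r]; these increase to the mean of [Z].  The two inequalities
yield [U n / n --> 1 / E Z], with the value 0 for an infinite mean
([elementary_renewal]).  Since [r] tends to 0, [M n / n] also does, and the
first inequality gives [U --> +oo] whether or not the mean is finite
([renewal_function_cvgy]).

On the probabilistic side, the point is that a color event of vertex [m] is
independent of every event that constrains finitely many of the later jumps
([color_event_independent]). *)

Set Implicit Arguments.
Unset Strict Implicit.
Unset Printing Implicit Defensive.

Import Order.TTheory GRing.Theory Num.Theory.
Import numFieldNormedType.Exports.

Local Open Scope classical_set_scope.
Local Open Scope ring_scope.

(** * Discrete renewal equations *)

Section RenewalEquation.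
Context {R : realDomainType}.
Implicit Types (f b x r : nat -> R) (c : R) (n m : nat).

Definition partial_sum x n : R := \sum_(k < n.+1) x k.

(** The convolution equation [x = b + f * x], where [f k] is the mass of a jump
of length [k.+1], so that [x n] depends on strictly earlier values only. *)
Definition renewal_eq f b x : Prop :=
  forall n, x n = b n + \sum_(k < n) f k * x (n - k.+1)%N.

Lemma partial_sumS x n : partial_sum x n.+1 = partial_sum x n + x n.+1.
Proof. by rewrite /partial_sum big_ord_recr. Qed.

(** Summation commutes with convolution by [f].  This turns the equations for
probabilities into equations for expected sizes. *)
Lemma renewal_partial_sum f b x :
  renewal_eq f b x -> renewal_eq f (partial_sum b) (partial_sum x).
Proof.
move=> xE; elim=> [|n IHn].
  by rewrite /partial_sum !big_ord_recr !big_ord0 /= xE big_ord0 !add0r.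
rewrite !partial_sumS IHn (xE n.+1) addrACA; congr (_ + _).
rewrite !big_ord_recr /= subnn addrA; congr (_ + _).
  rewrite -big_split /=; apply: eq_bigr => k _.
  by rewrite subSn ?ltn_ord // partial_sumS mulrDr.
by rewrite /partial_sum big_ord_recr big_ord0 /= add0r.
Qed.

(** Comparison principle: as [f] is nonnegative, the solution is monotone in
the forcing term. *)
Lemma renewal_le f b b' x x' :
  (forall k, 0 <= f k) -> (forall n, b n <= b' n) ->
  renewal_eq f b x -> renewal_eq f b' x' -> forall n, x n <= x' n.
Proof.
move=> f0 bb' xE x'E; elim/ltn_ind => n IHn.
rewrite xE x'E lerD ?bb' // ler_sum // => k _.
by rewrite ler_wpM2l ?f0 // IHn //; have := ltn_ord k; lia.
Qed.

Lemma renewal_scale c f b x :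
  renewal_eq f b x -> renewal_eq f (fun n => c * b n) (fun n => c * x n).
Proof.
move=> xE n; rewrite xE mulrDr mulr_sumr; congr (_ + _).
by apply: eq_bigr => k _; rewrite mulrCA.
Qed.

Lemma renewal_ge0 f b x :
  (forall k, 0 <= f k) -> (forall n, 0 <= b n) -> renewal_eq f b x ->
  forall n, 0 <= x n.
Proof.
move=> f0 b0 xE; elim/ltn_ind => n IHn.
rewrite xE addr_ge0 // sumr_ge0 // => k _.
by rewrite mulr_ge0 ?f0 // IHn //; have := ltn_ord k; lia.
Qed.

End RenewalEquation.

(** * The renewal function of a jump law with tail r *)

Section RenewalFunction.
Context {R : realDomainType}.
Variables (r U : nat -> R).
Hypothesis r0 : r 0%N = 1.
Hypothesis r_ge0 : forall k, 0 <= r k.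
Hypothesis r_noninc : forall k, r k.+1 <= r k.

Definition mass k := r k - r k.+1.

Hypothesis U_renewal : renewal_eq mass (fun=> 1) U.

Lemma mass_ge0 k : 0 <= mass k.
Proof. by rewrite subr_ge0. Qed.

Lemma sum_mass a n : \sum_(k < n) mass (k + a) = r a - r (n + a).
Proof.
elim: n => [|n IHn]; first by rewrite big_ord0 add0n subrr.
by rewrite big_ord_recr /= IHn /mass addSn addrA subrK.
Qed.

Lemma renewal_function_ge1 n : 1 <= U n.
Proof.
rewrite U_renewal lerDl sumr_ge0 // => k _; rewrite mulr_ge0 ?mass_ge0 //.
by apply: (renewal_ge0 _ _ U_renewal); first exact: mass_ge0.
Qed.

(** The difference of two consecutive instances is
[U n.+1 - \sum_(k < n.+1) mass k * U (n - k)], which is 1 by the renewal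
equation; the identity follows by induction. *)
Lemma sum_tail_renewal n : \sum_(k < n.+1) r k * U (n - k)%N = n.+1%:R.
Proof.
elim: n => [|n IHn].
  by rewrite big_ord_recr big_ord0 /= add0r r0 mul1r U_renewal big_ord0 addr0.
rewrite big_ord_recl /= r0 mul1r subn0 U_renewal.
rewrite -addrA -big_split /= [RHS]mulrS -IHn; congr (_ + _).
apply: eq_bigr => k _.
by rewrite /bump /= add1n !subSS -mulrDl subrK.
Qed.

Lemma renewal_function_homo : {homo U : m n / (m <= n)%N >-> m <= n}.
Proof.
apply: homo_leq => // [y x z|n]; first exact: le_trans.
elim/ltn_ind: n => n IHn; rewrite !U_renewal lerD2l big_ord_recr /= subnn.
apply: ler_wpDr.
  by rewrite mulr_ge0 ?mass_ge0 // (le_trans ler01) // renewal_function_ge1.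
apply: ler_sum => k _; have kn := ltn_ord k.
rewrite ler_wpM2l ?mass_ge0 // subSn //; exact: (IHn (n - k.+1)%N ltac:(lia)).
Qed.

(** Expand [U (n + m).+1] and [U n] by the renewal equation.  Jumps that stay
within the first [n] steps are handled by induction; a longer jump leaves at
most [m] steps, hence contributes at most [U m].  The masses have total at most
1, so [U m] is paid for only once. *)
Lemma renewal_function_subadd n m : U (n + m).+1 <= U n + U m.
Proof.
elim/ltn_ind: n m => n IHn m.
have U0 k : 0 <= U k by rewrite (le_trans ler01) // renewal_function_ge1.
rewrite (U_renewal (n + m).+1) (U_renewal n) -addrA lerD2l -addnS.
rewrite big_split_ord /=.
apply: (@le_trans _ _ (\sum_(k < n) mass k * (U (n - k.+1)%N + U m) +
                      \sum_(k < m.+1) mass (n + k)%N * U m)).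
  apply: lerD; apply: ler_sum => k _; rewrite ler_wpM2l ?mass_ge0 //.
    have kn := ltn_ord k.
    have -> : (n + m.+1 - k.+1 = (n - k.+1 + m).+1)%N by lia.
    by apply: IHn; lia.
  by apply: renewal_function_homo; lia.
rewrite (eq_bigr _ (fun (k : 'I_n) _ => mulrDr _ _ _)).
rewrite big_split /= -addrA lerD2l -!mulr_suml -mulrDl.
rewrite -[leRHS]mul1r ler_wpM2r //.
rewrite (_ : _ + _ = \sum_(k < n + m.+1) mass (k + 0)); last first.
  rewrite big_split_ord /=.
  by congr (_ + _); apply: eq_bigr => k _; rewrite addn0.
by rewrite sum_mass r0 lerBlDr lerDl.
Qed.

(** In [sum_tail_renewal], each [U (n - k)] is at most [U n]. *)
Lemma renewal_function_ge n : n.+1%:R <= U n * partial_sum r n.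
Proof.
rewrite -sum_tail_renewal /partial_sum mulr_sumr; apply: ler_sum => k _.
by rewrite mulrC ler_wpM2r // renewal_function_homo // leq_subr.
Qed.

(** In [sum_tail_renewal] at [n + m], keep only the terms [k <= m], for which
[U (n + m - k)] is at least [U n]. *)
Lemma renewal_function_le n m : U n * partial_sum r m <= (n + m).+1%:R.
Proof.
rewrite -sum_tail_renewal -addnS addnC big_split_ord /=.
apply: ler_wpDr.
  apply: sumr_ge0 => k _; rewrite mulr_ge0 //.
  by rewrite (le_trans ler01) // renewal_function_ge1.
rewrite /partial_sum mulr_sumr; apply: ler_sum => k _.
by rewrite mulrC ler_wpM2l // renewal_function_homo //; have := ltn_ord k; lia.
Qed.

(** The summed forcing term is [r a - r (a + n + 1)]: it starts at [mass a] and
stays below [r a].  The bounds are the solutions for these two constants. *)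
Lemma delayed_renewal_bounds a v : renewal_eq mass (fun n => mass (n + a)) v ->
  forall n, mass a * U n <= partial_sum v n <= r a * U n.
Proof.
move=> /renewal_partial_sum vE n; apply/andP; split.
- apply: renewal_le (renewal_scale (mass a) U_renewal) vE n.
    exact: mass_ge0.
  move=> n; rewrite mulr1 /partial_sum big_ord_recl /= add0n lerDl.
  by apply: sumr_ge0 => k _; exact: mass_ge0.
- apply: renewal_le vE (renewal_scale (r a) U_renewal) n.
    exact: mass_ge0.
  by move=> n; rewrite mulr1 /partial_sum sum_mass lerBlDr lerDl.
Qed.

End RenewalFunction.

(** * Growth of the renewal function *)

Section Asymptotics.
Context {R : realType}.
Variables (r U : nat -> R).
Hypothesis r0 : r 0%N = 1.
Hypothesis r_ge0 : forall k, 0 <= r k.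
Hypothesis r_noninc : forall k, r k.+1 <= r k.
Hypothesis U_renewal : renewal_eq (mass r) (fun=> 1) U.

Let M_gt0 n : 0 < partial_sum r n.
Proof.
rewrite /partial_sum big_ord_recl /= r0 ltr_wpDr //.
by apply: sumr_ge0 => k _.
Qed.

(** By Cesaro, the averages of [r] tend to 0, and [renewal_function_ge] bounds
[U] below by the inverse of these averages. *)
Lemma renewal_function_cvgy : r @ \oo --> 0 -> U @ \oo --> +oo.
Proof.
move=> /cesaro; rewrite /arithmetic_mean => mean0.
apply/cvgryPge => A.
(* The threshold is raised to be positive, so that it can be inverted. *)
have A0 : 0 < Num.max A 1 by rewrite lt_max ltr01 orbT.
near=> n.
suff : Num.max A 1 <= U n by apply: le_trans; rewrite le_max lexx.
have : n.+1%:R^-1 * partial_sum r n <= (Num.max A 1)^-1.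
  rewrite /partial_sum -(big_mkord xpredT r).
  apply: le_trans (ler_norm _) _.
  near: n; move/cvgr0Pnorm_le : mean0 => /(_ (Num.max A 1)^-1).
  by rewrite invr_gt0 => /(_ A0).
rewrite mulrC ler_pdivrMr // => Mn.
have := renewal_function_ge r0 r_ge0 r_noninc U_renewal n.
move=> h; rewrite -(@ler_pM2r _ (partial_sum r n)) //.
apply: le_trans h; rewrite -ler_pdivlMl //.
Unshelve. all: by end_near. Qed.

(** The hypotheses say that [l] is the reciprocal of the supremum of
[partial_sum r], in a form that also makes sense, with [l = 0], when this
supremum is infinite. *)
Lemma elementary_renewal (l : R) :
  (forall n, partial_sum r n * l <= 1) ->
  (forall e, 0 < e -> exists m, 1 <= (l + e) * partial_sum r m) ->
  (U n / n%:R) @[n --> \oo] --> l.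
Proof.
move=> Ml Me; apply/cvgrPdist_le => e e0.
have l0 : 0 <= l.
  rewrite leNgt; apply/negP => l0.
  have [m] : exists m, 1 <= (l + - l) * partial_sum r m by apply: Me; lra.
  by rewrite subrr mul0r ler10.
have [m Mm] := Me (e / 2) ltac:(lra).
near=> n.
have n0 : 0 < n%:R :> R by rewrite ltr0n; near: n; exists 1%N.
(* With [m] fixed, [(n + m + 1) / n] tends to 1. *)
have nm : m.+1%:R * (l + e / 2) <= n%:R * (e / 2).
  rewrite -ler_pdivrMr; last lra.
  by near: n; exact: nbhs_infty_ger.
have lo : l <= U n / n%:R.
  rewrite ler_pdivlMr //.
  have := renewal_function_ge r0 r_ge0 r_noninc U_renewal n.
  have := Ml n; have := M_gt0 n.
  rewrite -natr1; nra.
have hi : U n / n%:R <= l + e.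
  rewrite ler_pdivrMr //.
  have := renewal_function_le r0 r_ge0 r_noninc U_renewal n m.
  have := M_gt0 m; have := renewal_function_ge1 r_noninc U_renewal n.
  rewrite -addnS natrD; nra.
by rewrite distrC ger0_norm; lra.
Unshelve. all: by end_near. Qed.

End Asymptotics.

(** Supplies the hypotheses of [elementary_renewal] for a finite and an infinite
limit at once, thanks to [+oo^-1 = 0]. *)
Lemma cvg_reciprocal_bounds (R : realType) (M : nat -> R) (E : \bar R) :
  0 < M 0%N -> {homo M : m n / (m <= n)%N >-> m <= n} ->
  (M n)%:E @[n --> \oo] --> E ->
  [/\ E^-1%E \is a fin_num,
      forall n, M n * fine E^-1%E <= 1 &
      forall e, 0 < e -> exists m, 1 <= (fine E^-1%E + e) * M m].
Proof.
move=> M0 M_homo; case: E => [mu||] ME.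
- have {ME} Mmu : M @ \oo --> mu by apply/fine_cvg: ME.
  have le_mu n : M n <= mu.
    rewrite -(cvg_lim _ Mmu) //.
    by apply: nondecreasing_cvgn_le => //; apply: cvgP Mmu.
  have mu0 : 0 < mu by exact: lt_le_trans (le_mu 0%N).
  rewrite inver gt_eqF //=; split=> // [n|e e0].
    by rewrite ler_pdivrMr ?mul1r.
  have l0 : 0 < mu^-1 + e by rewrite addr_gt0 ?invr_gt0.
  have lt_mu : (mu^-1 + e)^-1 < mu.
    by rewrite -[ltRHS]invrK ltf_pV2 ?posrE ?invr_gt0 // ltrDl.
  have [m _ Mm] := cvgr_gt _ Mmu _ lt_mu.
  exists m; rewrite -ler_pdivrMl // mulr1; exact/ltW/Mm/leqnn.
- rewrite invey /=; split=> // [n|e e0]; first by rewrite mulr0.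
  move/cvgeryP/cvgryPge : ME => /(_ e^-1) [m _ Mm].
  by exists m; rewrite add0r -ler_pdivrMl // mulr1; exact: Mm (leqnn m).
- move/cvgeNyPle : ME => /(_ 0) [m _ /(_ m (leqnn m))].
  by rewrite lee_fin leNgt (lt_le_trans M0 (M_homo 0%N m (leq0n m))).
Qed.

(** * Probabilities of color events *)

(** A jump from [m.+1] into the nonpositive integers lands on [i] only if its
length is [m.+1 + |i|].  Thus, although [Z] may take infinitely many values, a
color event splits into finitely many cases. *)
Lemma color_succ (z : nat -> nat) (i : int) (m : nat) :
  (forall t, (0 < t)%N -> (0 < z t)%N) -> i <= 0 ->
  color z m.+1%:Z = i <->
  z m.+1 = (m.+1 + `|i|)%N \/
  exists k : 'I_m, z m.+1 = k.+1 /\ color z (m - k)%N%:Z = i.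
Proof.
move=> z_gt0 i0; rewrite color_step //.
have zm := z_gt0 m.+1 isT.
have [zle|zgt] := leqP (z m.+1) m; last first.
  rewrite color_root; last lia.
  split=> [?|[?|[k [zk _]]]]; [left; lia|lia|].
  by have := ltn_ord k; lia.
have -> : m.+1%:Z - (z m.+1)%:Z = (m - (z m.+1).-1)%N%:Z by lia.
split=> [zi|[?|[k [-> //]]]]; last lia.
have zk : ((z m.+1).-1 < m)%N by lia.
by right; exists (Ordinal zk); split=> //=; lia.
Qed.

Section TreeSizes.
Context d (T : measurableType d) (R : realType) (P : probability T R).
Variable Z : nat -> {RV P >-> nat}.
Hypothesis Z_pos : forall n w, (0 < Z n w)%N.
Hypothesis Z_iid : iid Z.

Definition pr (A : set T) : R := fine (P A).

Definition jump_event (n k : nat) : set T := [set w | Z n w = k].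

Definition color_event (i : int) (m : nat) : set T :=
  [set w | color (fun t => Z t w) m%:Z = i].

Definition tail (k : nat) : R := pr [set w | (k < Z 0%N w)%N].

Lemma prE A : measurable A -> P A = (pr A)%:E.
Proof. by move=> mA; rewrite fineK // fin_num_measure. Qed.

Lemma measurable_preimage n (B : set nat) : measurable (Z n @^-1` B).
Proof. by apply: (measurable_funPTI (Z n)). Qed.

Lemma measurable_jump_event n k : measurable (jump_event n k).
Proof. exact: (measurable_preimage n [set k]). Qed.

Lemma pr_ge0 A : 0 <= pr A.
Proof. exact: fine_ge0. Qed.

Lemma prT : pr setT = 1.
Proof. by rewrite /pr probability_setT. Qed.

Lemma prU A B : measurable A -> measurable B -> A `&` B = set0 ->
  pr (A `|` B) = pr A + pr B.
Proof.
by move=> mA mB AB; rewrite /pr measureU // fineD // fin_num_measure.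
Qed.

Lemma pr_bigsetU n (F : 'I_n -> set T) : (forall k, measurable (F k)) ->
  trivIset setT F -> pr (\big[setU/set0]_(k < n) F k) = \sum_(k < n) pr (F k).
Proof.
move=> mF tF; apply: EFin_inj; rewrite -prE; last exact: bigsetU_measurable.
rewrite measure_bigsetU_ord // -sumEFin.
by apply: eq_bigr => k _; exact: prE.
Qed.

(** Events constraining finitely many jumps with index greater than [m].  They
are kept as explicit finite intersections because mutual independence is
expressed by the product rule for such intersections. *)
Definition determined_after (m : nat) (F : set T) : Prop :=
  exists (J : {fset nat}) (B : nat -> set nat),
    [/\ forall j, measurable (B j), forall j, j \in J -> (m < j)%N &
        F = \bigcap_(j in [set` J]) Z j @^-1` B j].

Lemma determined_after_setT m : determined_after m setT.
Proof.
by exists fset0, (fun=> setT); split=> //; rewrite set_fset0 bigcap_set0.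
Qed.

Lemma determined_after_le m m' F : (m <= m')%N ->
  determined_after m' F -> determined_after m F.
Proof.
move=> mm' [J [B [mB Jm ->]]]; exists J, B; split=> // j /Jm.
exact: leq_ltn_trans.
Qed.

Lemma measurable_determined_after m F : determined_after m F -> measurable F.
Proof.
move=> [J [B [mB _ ->]]]; apply: bigcap_measurableType => j _.
exact: measurable_preimage.
Qed.

(** Adding a constraint on the jump of [m.+1] is independent of the later ones,
and keeps the event in the form needed for the induction in
[color_event_independent]. *)
Lemma determined_after_jump m k F : determined_after m.+1 F ->
  determined_after m (jump_event m.+1 k `&` F) /\
  pr (jump_event m.+1 k `&` F) = pr (jump_event m.+1 k) * pr F.
Proof.
move=> F_after; have mF := measurable_determined_after F_after.
case: F_after => J [B [mB Jm FE]].
have mJ : m.+1 \notin J by apply/negP => /Jm; rewrite ltnn.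
(* The constraint on [m.+1] is free in [F], so it can be set to [k]. *)
pose B' j := if j == m.+1 then [set k] else B j.
have mB' j : measurable (B' j) by rewrite /B'; case: ifP.
have FE' : F = \bigcap_(j in [set` J]) Z j @^-1` B' j.
  rewrite FE; apply: eq_bigcapr => j Jj.
  by rewrite /B'; case: eqP => // jm; rewrite -jm Jj in mJ.
have capE : jump_event m.+1 k `&` F =
    \bigcap_(j in [set` (m.+1 |` J)%fset]) Z j @^-1` B' j.
  by rewrite bigcap_fsetU1 -FE' /B' eqxx.
split.
  exists (m.+1 |` J)%fset, B'; split=> // j.
  by rewrite !inE => /orP[/eqP ->|/Jm /ltnW].
have mjump := measurable_jump_event m.+1 k.
apply: EFin_inj; rewrite EFinM -!prE //; last exact: measurableI.
rewrite capE Z_iid.1 // big_fsetU1 //= -Z_iid.1 // -FE'.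
by rewrite /B' eqxx.
Qed.

Lemma tail_mass k : mass tail k = pr (jump_event 0 k.+1).
Proof.
rewrite /mass /tail.
rewrite (_ : [set w | (k < Z 0%N w)%N] =
    jump_event 0 k.+1 `|` [set w | (k.+1 < Z 0%N w)%N]).
  rewrite prU ?addrK //; first exact: measurable_jump_event.
    exact: (measurable_preimage 0%N [set n | (k.+1 < n)%N]).
  by rewrite -subset0 => w [/= ]; rewrite /jump_event /=; lia.
by apply/seteqP; split=> w; rewrite /jump_event /=; [move=> ?|case]; lia.
Qed.

Lemma pr_jump_event n k : pr (jump_event n k.+1) = mass tail k.
Proof.
by rewrite tail_mass /pr; congr fine; exact: (Z_iid.2 n 0%N [set k.+1]).
Qed.

Section FixedRoot.
Variable i : int.
Hypothesis i_le0 : i <= 0.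

Lemma color_event_succ m : color_event i m.+1 =
  jump_event m.+1 (m.+1 + `|i|) `|`
  \big[setU/set0]_(k < m) (color_event i (m - k) `&` jump_event m.+1 k.+1).
Proof.
apply/seteqP; split=> w.
  rewrite /color_event /= color_succ // => -[zi|[k [zk ck]]]; [by left|right].
  by rewrite -bigcup_seq; exists k => //=; rewrite mem_index_enum.
rewrite /color_event /= color_succ // => -[zi|wU]; [by left|right].
by move: wU; rewrite -bigcup_seq => -[k _ [? ?]]; exists k.
Qed.

Lemma color_event0 : color_event i 0 = if i == 0 then setT else set0.
Proof.
by apply/seteqP; split=> w; rewrite /color_event /color /= eq_sym;
  case: eqP => // ->.
Qed.

Lemma measurable_color_event m : measurable (color_event i m).
Proof.
elim/ltn_ind: m => -[_|m IHm].
  by rewrite color_event0; case: ifP.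
rewrite color_event_succ; apply: measurableU; first exact: measurable_jump_event.
apply: bigsetU_measurable => k _; apply: measurableI.
  by apply: IHm; lia.
exact: measurable_jump_event.
Qed.

Lemma pr_color_event_setI m F : measurable F ->
  pr (color_event i m.+1 `&` F) = pr (jump_event m.+1 (m.+1 + `|i|) `&` F) +
    \sum_(k < m) pr (color_event i (m - k) `&` (jump_event m.+1 k.+1 `&` F)).
Proof.
move=> mF; rewrite color_event_succ setIUl.
have mpiece k :
    measurable (color_event i (m - k) `&` (jump_event m.+1 k.+1 `&` F)).
  apply: measurableI; first exact: measurable_color_event.
  by apply: measurableI => //; exact: measurable_jump_event.
rewrite big_distrl /=.
under eq_bigr do rewrite -setIA.
rewrite prU.
- rewrite pr_bigsetU // => k l _ _ [w [[_ [/= kE _]] [_ [/= lE _]]]].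
  by apply: val_inj; rewrite /jump_event /= in kE lE *; lia.
- by apply: measurableI => //; exact: measurable_jump_event.
- by apply: bigsetU_measurable.
- rewrite -subset0 => w [[/= zw _]].
  rewrite -bigcup_seq => -[k _ [_ [/= zk _]]].
  by have := ltn_ord k; rewrite /jump_event /= in zk zw; lia.
Qed.

(** Induction on [m]: after a jump of length [k.+1] from [m.+1], the color event
is that of [m - k], while the constraint on the jump joins those on the later
jumps.  Keeping [F] general is what makes this step possible. *)
Lemma color_event_independent m F : determined_after m F ->
  pr (color_event i m `&` F) = pr (color_event i m) * pr F.
Proof.
elim/ltn_ind: m F => -[_ F _|m IHm F F_after].
  rewrite color_event0; case: ifP => _.
    by rewrite setTI prT mul1r.
  by rewrite set0I /pr measure0 mul0r.
have split_pr G : determined_after m.+1 G -> pr (color_event i m.+1 `&` G) =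
    (pr (jump_event m.+1 (m.+1 + `|i|)) +
     \sum_(k < m) pr (color_event i (m - k)) * pr (jump_event m.+1 k.+1)) * pr G.
  move=> G_after; rewrite pr_color_event_setI; last first.
    exact: measurable_determined_after G_after.
  rewrite (determined_after_jump _ G_after).2 mulrDl mulr_suml.
  congr (_ + _); apply: eq_bigr => k _.
  have [after prG] := determined_after_jump k.+1 G_after.
  rewrite IHm ?prG ?mulrA //; first by lia.
  by apply: determined_after_le after; exact: leq_subr.
rewrite split_pr // -[color_event i m.+1]setIT split_pr.
  by rewrite prT mulr1.
exact: determined_after_setT.
Qed.

Lemma pr_color_event_succ m : pr (color_event i m.+1) =
  mass tail (m + `|i|) + \sum_(k < m) mass tail k * pr (color_event i (m - k)).
Proof.
rewrite -[color_event i m.+1]setIT pr_color_event_setI // setIT.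
rewrite addSn pr_jump_event; congr (_ + _); apply: eq_bigr => k _.
have [after prG] := determined_after_jump k.+1 (determined_after_setT m.+1).
rewrite color_event_independent ?prG.
  by rewrite prT mulr1 pr_jump_event mulrC.
by apply: determined_after_le after; exact: leq_subr.
Qed.

End FixedRoot.

(** * Expected tree sizes as sums of probabilities *)

Let measurable_EFin_indic (A : set T) : measurable A ->
  measurable_fun setT (EFin \o (\1_A : T -> R)).
Proof. by move=> mA; apply/measurable_EFinP; exact: measurable_indic. Qed.

Lemma integral_sum_indic (A : nat -> set T) n : (forall t, measurable (A t)) ->
  (\int[P]_w (\sum_(0 <= t < n.+1) (\1_(A t) w)%:E) =
   (partial_sum (pr \o A) n)%:E)%E.
Proof.
move=> mA; rewrite ge0_integral_sum //; last first.
  by move=> t; exact: measurable_EFin_indic.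
rewrite /partial_sum -(big_mkord xpredT (pr \o A)) -sumEFin.
by apply: eq_bigr => t _; rewrite integral_indic // setIT; exact: prE.
Qed.

Lemma cvg_partial_sum_pr (A : nat -> set T) : (forall t, measurable (A t)) ->
  (partial_sum (pr \o A) n)%:E @[n --> \oo] -->
  (\int[P]_w \sum_(0 <= t <oo) (\1_(A t) w)%:E)%E.
Proof.
move=> mA; rewrite integral_nneseries //; last first.
  by move=> t; exact: measurable_EFin_indic.
have -> : (fun n => (partial_sum (pr \o A) n)%:E) =
    [sequence (\sum_(0 <= t < n.+1) \int[P]_w (\1_(A t) w)%:E)%E]_n.
  apply/funext => n; rewrite -integral_sum_indic // ge0_integral_sum //.
  by move=> t; exact: measurable_EFin_indic.
rewrite (cvg_shiftS (fun n => \sum_(0 <= t < n) \int[P]_w (\1_(A t) w)%:E)%E).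
by apply: is_cvg_nneseries => n _ _; apply: integral_ge0 => w _; rewrite lee_fin.
Qed.

(** Index 0 stands for the root itself, which is why it is the sure event for
every [i]; this absorbs the summand 1 in the tree sizes. *)
Definition in_tree_event (i : int) (t : nat) : set T :=
  if t is 0%N then setT else color_event i t.

Lemma measurable_in_tree_event i t : i <= 0 -> measurable (in_tree_event i t).
Proof.
move=> i0; case: t => [|t]; first exact: measurableT.
exact: measurable_color_event.
Qed.

Let indic_in_tree_succ i t w :
  \1_(in_tree_event i t.+1) w = (color (fun t => Z t w) t.+1%:Z == i)%:R :> R.
Proof.
by rewrite indicE; congr (nat_of_bool _)%:R; apply/idP/eqP; rewrite inE.
Qed.

Lemma expected_tree_sizeE i n : i <= 0 ->
  expected_tree_size Z i n = (partial_sum (pr \o in_tree_event i) n)%:E.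
Proof.
move=> i0; rewrite -integral_sum_indic; last first.
  by move=> t; exact: measurable_in_tree_event.
rewrite /expected_tree_size unlock; apply: eq_integral => w _.
rewrite sumEFin; congr EFin; rewrite /tree_size natrD natr_sum.
rewrite big_add1 [RHS]big_nat_recl // indicT; congr (_ + _).
by apply: eq_bigr => t _; rewrite indic_in_tree_succ.
Qed.

Lemma cvg_expected_tree_size i : i <= 0 ->
  expected_tree_size Z i n @[n --> \oo] --> expected_final_tree_size Z i.
Proof.
move=> i0; under eq_cvg do rewrite expected_tree_sizeE //.
rewrite (_ : expected_final_tree_size Z i =
    (\int[P]_w \sum_(0 <= t <oo) (\1_(in_tree_event i t) w)%:E)%E).
  by apply: cvg_partial_sum_pr => t; exact: measurable_in_tree_event.
apply: eq_integral => w _; rewrite /final_tree_size.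
rewrite (@nneseries_split _ _ 0%N 1%N); last by move=> k _; rewrite lee_fin.
rewrite add0n big_nat1 /= indicT; congr (_ + limn _)%E; apply/funext => n.
by apply: eq_big_nat => -[//|t] _; rewrite indic_in_tree_succ.
Qed.

Let tail_event k := [set w | (k < Z 0%N w)%N].

Let measurable_tail_event k : measurable (tail_event k).
Proof. exact: (measurable_preimage 0%N [set n | (k < n)%N]). Qed.

(** The layer-cake formula: [Z] is the number of [k] with [k < Z]. *)
Lemma cvg_sum_tail :
  (partial_sum tail n)%:E @[n --> \oo] --> ('E_P[fun w => (Z 0%N w)%:R : R])%E.
Proof.
rewrite (_ : 'E_P[_]%E =
    (\int[P]_w \sum_(0 <= k <oo) (\1_(tail_event k) w)%:E)%E).
  exact: cvg_partial_sum_pr.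
rewrite unlock; apply: eq_integral => w _.
rewrite (@nneseries_split _ _ 0%N (Z 0%N w)); last by move=> k _; rewrite lee_fin.
rewrite add0n [X in (_ + X)%E]eseries0 ?adde0; last first.
  by move=> k kZ _; rewrite indicE memNset // /tail_event /=; lia.
rewrite (eq_big_nat _ _ (F2 := fun=> 1%:E)); last first.
  by move=> k kZ; rewrite indicE mem_set //; case/andP: kZ.
by rewrite sumEFin sumr_const_nat subn0.
Qed.

Lemma tail0 : tail 0%N = 1.
Proof.
rewrite /tail (_ : [set w | _] = setT) ?prT //.
by apply/seteqP; split=> w //= _.
Qed.

Lemma tail_ge0 k : 0 <= tail k.
Proof. exact: pr_ge0. Qed.

Lemma tail_noninc k : tail k.+1 <= tail k.
Proof.
rewrite -lee_fin /tail -!prE; [|exact: measurable_tail_event..].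
apply: (@le_measure _ _ _ P); rewrite ?inE; [exact: measurable_tail_event..|].
by move=> w /= /ltnW.
Qed.

Lemma cvg_tail : tail @ \oo --> 0.
Proof.
have cap0 : \bigcap_k tail_event k = set0.
  by rewrite -subset0 => w /(_ (Z 0%N w) I); rewrite /tail_event /= ltnn.
apply: (@fine_cvg _ _ _ _ (P \o tail_event)).
have <- : P (\bigcap_k tail_event k) = 0%:E by rewrite cap0 measure0.
apply: nonincreasing_cvg_mu.
- by rewrite ltey_eq fin_num_measure.
- exact: measurable_tail_event.
- by apply: bigcap_measurableType => k _; exact: measurable_tail_event.
- by move=> m n mn; apply/subsetPset => w /=; exact: leq_ltn_trans.
Qed.

Lemma tail_probE (i : int) : i <= 0 ->
  tail_prob (Z 0%N) (1 - i) = (tail `|i|)%:E.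
Proof.
move=> i0; rewrite /tail_prob (_ : [set w | _] = tail_event `|i|%N).
  exact/prE/measurable_tail_event.
by apply/seteqP; split=> w; rewrite /tail_event /=; lia.
Qed.

Lemma point_probE k : point_prob (Z 0%N) k.+1 = (mass tail k)%:E.
Proof. by rewrite tail_mass //; exact/prE/measurable_jump_event. Qed.

(** * Comparison with the renewal function *)

Definition mean_size (i : int) : nat -> R :=
  partial_sum (pr \o in_tree_event i).

(** For the root 0 the in-tree probabilities solve the renewal equation with
forcing term the indicator of 0, whose partial sums are constantly 1. *)
Lemma mean_size_root_renewal : renewal_eq (mass tail) (fun=> 1) (mean_size 0).
Proof.
have -> : (fun=> 1 : R) = partial_sum (fun n => (n == 0%N)%:R).
  apply/funext => n; rewrite /partial_sum big_ord_recl big1 ?addr0 //.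
apply: renewal_partial_sum => -[|n] /=.
  by rewrite big_ord0 addr0 prT.
rewrite add0r pr_color_event_succ // big_ord_recr /= subnn prT mulr1 addn0 addrC.
congr (_ + _); apply: eq_bigr => k _; rewrite subSS.
by case: (n - k)%N (ltn_ord k) (subn_gt0 k n) => [|m] // ->.
Qed.

(** The probabilities of being in the tree of [i] solve the renewal equation
whose forcing term is the mass of a jump directly onto [i]. *)
Lemma mean_size_succ_bounds i n : i <= 0 ->
  mass tail `|i| * mean_size 0 n <= mean_size i n.+1 - 1
    <= tail `|i| * mean_size 0 n.
Proof.
move=> i0.
have vE : renewal_eq (mass tail) (fun n => mass tail (n + `|i|))
    (fun n => pr (color_event i n.+1)).
  move=> m; rewrite pr_color_event_succ //; congr (_ + _).
  by apply: eq_bigr => k _; rewrite subnSK.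
have -> : mean_size i n.+1 - 1 =
    partial_sum (fun n => pr (color_event i n.+1)) n.
  rewrite /mean_size /partial_sum big_ord_recl /= prT addrC addKr.
  by apply: eq_bigr => k _.
apply: delayed_renewal_bounds vE n.
- exact: tail_ge0.
- exact: tail_noninc.
- exact: mean_size_root_renewal.
Qed.

Lemma mean_size_ge0 i n : 0 <= mean_size i n.
Proof. by apply: sumr_ge0 => k _; exact: pr_ge0. Qed.

Lemma mean_size_homo i : {homo mean_size i : m n / (m <= n)%N >-> m <= n}.
Proof.
apply: homo_leq => // [y x z|n]; first exact: le_trans.
by rewrite /mean_size partial_sumS lerDl pr_ge0.
Qed.

Lemma mean_size_le i n : i <= 0 ->
  mean_size i n <= 1 + tail `|i| * mean_size 0 n.
Proof.
move=> i0; case: n => [|n].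
  rewrite /mean_size /partial_sum big_ord_recl big_ord0 addr0 /= prT lerDl.
  by rewrite mulr_ge0 ?tail_ge0 // mean_size_ge0.
rewrite -lerBlDl; have /andP[_ /le_trans->//] := mean_size_succ_bounds n i0.
by rewrite ler_wpM2l ?tail_ge0 // mean_size_homo.
Qed.

Lemma mean_size_cvgy i : i <= 0 -> 0 < mass tail `|i| ->
  mean_size i @ \oo --> +oo.
Proof.
move=> i0 q0; rewrite -cvg_shiftS.
have := renewal_function_cvgy tail0 tail_ge0 tail_noninc
  mean_size_root_renewal (cvg_tail).
move=> /cvgryPge Uy; apply/cvgryPge => A.
near=> n; have /andP[+ _] := mean_size_succ_bounds n i0.
rewrite lerBrDr /=; apply: le_trans; rewrite -lerBlDr -ler_pdivrMl //.
by near: n; exact: Uy.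
Unshelve. all: by end_near. Qed.

Let EZ := ('E_P[fun w => (Z 0%N w)%:R : R])%E.

Lemma reciprocal_mean_bounds :
  [/\ EZ^-1%E \is a fin_num,
      forall n, partial_sum tail n * fine EZ^-1%E <= 1 &
      forall e, 0 < e ->
        exists m, 1 <= (fine EZ^-1%E + e) * partial_sum tail m].
Proof.
apply: (@cvg_reciprocal_bounds _ (partial_sum tail)); last exact: cvg_sum_tail.
  by rewrite /partial_sum big_ord_recl big_ord0 addr0 /= tail0.
apply: homo_leq => // [y x z|n]; first exact: le_trans.
by rewrite partial_sumS lerDl tail_ge0.
Qed.

Lemma mean_size_root_rate : mean_size 0 n / n%:R @[n --> \oo] --> fine EZ^-1%E.
Proof.
have [_ Mle Mge] := reciprocal_mean_bounds.
apply: (elementary_renewal tail0 tail_ge0 tail_noninc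
  mean_size_root_renewal) => //.
Qed.

Lemma mean_size_rate0 i : i <= 0 -> EZ = +oo%E ->
  mean_size i n / n%:R @[n --> \oo] --> 0.
Proof.
move=> i0 EZy; have := mean_size_root_rate; rewrite EZy invey /= => rate0.
have : (n%:R^-1 + tail `|i| * (mean_size 0 n / n%:R)) @[n --> \oo] --> (0 : R).
  rewrite -[0 : R]addr0 -[X in _ + X](mulr0 (tail `|i|)).
  apply: cvgD; last exact: cvgMr.
  by rewrite -cvg_shiftS; exact: cvg_harmonic.
apply: squeeze_cvgr (cvg_cst _); near=> n.
rewrite mulr_ge0 ?mean_size_ge0 ?invr_ge0 //= mulrA.
rewrite -[X in X + _]mul1r -mulrDl.
by rewrite ler_wpM2r ?invr_ge0 // mean_size_le.
Unshelve. all: by end_near. Qed.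

(** The ratio stays above [mass tail |i|] divided by the mean, because [U n] is
at least [n + 1] divided by the mean. *)
Lemma mean_size_rate_neq0 i : i <= 0 -> 0 < mass tail `|i| -> EZ != +oo%E ->
  ~ (mean_size i n / n%:R @[n --> \oo] --> 0).
Proof.
move=> i0 q0 EZfin rate0.
have [EZVfin Mle Mge] := reciprocal_mean_bounds.
have l0 : 0 < fine EZ^-1%E.
  rewrite fine_gt0 // ltey_eq EZVfin andbT lt_def inve_eq0 EZfin inve_ge0.
  by apply: expectation_ge0 => w.
have := cvgr_lt _ rate0 _ (mulr_gt0 q0 l0) => -[N _ /(_ N.+1 (leqnSn N))] /=.
apply/negP; rewrite -leNgt ler_pdivlMr //.
have /andP[+ _] := mean_size_succ_bounds N i0.
have := renewal_function_ge tail0 tail_ge0 tail_noninc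
  mean_size_root_renewal N.
have := Mle N; have := mean_size_ge0 0 N.
move: (mean_size 0 N) (partial_sum tail N) => U M U0 Ml NU lo.
have Ul : N.+1%:R * fine EZ^-1%E <= U.
  have : U * (M * fine EZ^-1%E) <= U by rewrite ler_piMr.
  by apply: le_trans; rewrite mulrA ler_wpM2r // ltW.
have : mass tail `|i| * (N.+1%:R * fine EZ^-1%E) <= mass tail `|i| * U.
  by rewrite ler_wpM2l // ltW.
rewrite -mulrA [fine _ * _]mulrC; lra.
Qed.

End TreeSizes.

(** * The theorem *)

Local Open Scope ereal_scope.

(* [Z 0] is the generic copy Z; [Z n] for n >= 1 is Z_n. *)
Theorem proposition1 (d : measure_display) (T : measurableType d)
    (R : realType) (P : probability T R) (Z : nat -> {RV P >-> nat})
    (Z_pos : forall (n : nat) (w : T), (0 < Z n w)%N) (Z_iid : iid Z) :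
  let Rn := expected_tree_size Z in
  let EZ := 'E_P[fun w => (Z 0%N w)%:R : R] in
  let q := point_prob (Z 0%N) in
  let p := tail_prob (Z 0%N) in
  let R0 := fun n : nat => if n == 0%N then 0 else Rn 0%R n in
  [/\ (forall n : nat, (0 < n)%N -> 0 < q n) ->
        forall i : int, (i <= 0)%R ->
          (Rn i n @[n --> \oo] --> +oo) /\
          expected_final_tree_size Z i = +oo,
      forall n m : nat, R0 (n + m)%N <= R0 n + R0 m,
      (forall n : nat, (0 < n)%N -> 0 < q n) ->
        forall i : int, (i <= 0)%R ->
          ((Rn i n / n%:R%:E) @[n --> \oo] --> 0) <-> EZ = +oo,
      EZ < +oo ->
        (Rn 0%R n / n%:R%:E) @[n --> \oo] --> EZ^-1 &
      forall (i : int) (n : nat), (i <= 0)%R -> (0 < n)%N ->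
        Rn i n <= 1 + p (1 - i)%R * Rn 0%R n].
Proof.
move=> Rn EZ q p R0.
have RnE i n : (i <= 0)%R -> Rn i n = (mean_size Z i n)%:E.
  by move=> i0; exact: expected_tree_sizeE.
have mass_gt0 i : (forall n : nat, (0 < n)%N -> 0 < q n) ->
    (0 < mass (tail Z) `|i|%N)%R.
  by move=> q0; rewrite -lte_fin -point_probE //; exact: q0.
(* The shift by one step avoids the ratio at [n = 0], whose denominator is 0. *)
have rateE i (l : R) : (i <= 0)%R ->
    (Rn i n / n%:R%:E) @[n --> \oo] --> l%:E <->
    (mean_size Z i n / n%:R)%R @[n --> \oo] --> l.
  move=> i0; rewrite -(cvg_shiftS (fun n => Rn i n / _)).
  rewrite -(cvg_shiftS (fun n => mean_size Z i n / _)%R).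
  rewrite (_ : [sequence _]_n =
      EFin \o [sequence (mean_size Z i n.+1 / n.+1%:R)%R]_n).
    by split=> [/fine_cvg //|rate]; apply: cvg_EFin => //; near=> n.
  by apply/funext => n /=; rewrite RnE // inver pnatr_eq0.
have final_cvg := cvg_expected_tree_size Z_pos.
split.
- move=> q0 i i0.
  have Ry : Rn i n @[n --> \oo] --> +oo.
    under eq_cvg do rewrite RnE //.
    by apply/cvgeryP; exact: mean_size_cvgy (mass_gt0 _ q0).
  split=> //; apply: cvg_unique Ry => //.
  exact: final_cvg.
- move=> [|n] [|m]; rewrite /R0 ?add0n ?addn0 ?adde0 ?add0e //=.
  rewrite !RnE // -EFinD lee_fin.
  have := renewal_function_subadd (tail0 Z_pos) (tail_ge0 Z) (tail_noninc Z)
    (mean_size_root_renewal Z_pos Z_iid) n.+1 m.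
  rewrite -addnS => /le_trans; apply.
  by rewrite lerD2l mean_size_homo.
- move=> q0 i i0; rewrite (rateE i 0%R) //; split.
    move=> rate0; apply/eqP; apply: contraPT rate0 => EZfin.
    exact: mean_size_rate_neq0 (mass_gt0 _ q0) EZfin.
  exact: mean_size_rate0.
- move=> _; have [EZVfin _ _] := reciprocal_mean_bounds Z_pos.
  rewrite -(fineK EZVfin); apply/rateE => //; exact: mean_size_root_rate.
- move=> i n i0 n0; rewrite !RnE // /p tail_probE // -EFinM -EFinD lee_fin.
  exact: mean_size_le.
Unshelve. all: by end_near. Qed.
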